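(* Let $H$ be a graph and $T\subseteq V(H)$ with $|T|$ odd. Let $G=G(\mathcal{TS}(H,T))$ and $\tilde G=\tilde G(\mathcal{TS}(H,T))$. Then there is a degree-$2$ Nullstellensatz refutation of $\mathsf P_{\mathrm{iso}}(G,\tilde G)$ over $\mathbb F_2$.
   Context: Tseitin CSP $\mathcal{TS}(H,T)$ over $\mathbb Z_2$: there is a variable $z_e$ for every edge $e\in E(H)$. For each vertex $v\in V(H)$, with incident edges $e_1,\dots,e_k$ in some fixed arbitrary order, let $\Delta=\{(i_1,\dots,i_k)\in\mathbb Z_2^k:\sum_j i_j=0\}$; the constraint $C_v$ is $((z_{e_1},\dots,z_{e_k}),R_v)$ with $R_v=\Delta$ if $v\notin T$ and $R_v=\Delta+(1,0,\dots,0)$ if $v\in T$. The coloured graph $G=G(\mathcal{TS}(H,T))$: for each edge $e$ there are vertices $0^{(e)},1^{(e)}$, both with colour $L^{(e)}$; for each vertex $v\in V(H)$ (incident edges $e_1,\dots,e_k$) there are vertices $\beta^{(v)}$ for all $\beta=(\beta_1,\dots,\beta_k)\in R_v$, all with colour $L^{(v)}$, and for each such $\beta$ and $i\in[k]$ an edge $\{\beta^{(v)},\beta_i^{(e_i)}\}$ of colour $M^{(i)}$. The graph $\tilde G=\tilde G(\mathcal{TS}(H,T))$ is defined identically except that $R_v$ is replaced by $\Delta$ for every $v$ (colours $L^{(e)},L^{(v)},M^{(i)}$ are the same as in $G$). Coloured graphs: isomorphisms and local isomorphisms preserve vertex and edge colours. A local isomorphism from $G$ to $\tilde G$ is an injective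 colour-preserving map $\pi$ with domain in $V(G)$ and range in $V(\tilde G)$ (a subset of $V(G)\times V(\tilde G)$) with $vv'\in E(G)\iff\pi(v)\pi(v')\in E(\tilde G)$, edge colours preserved. $\mathsf P_{\mathrm{iso}}(G,\tilde G)$ in variables $x_{vw}$ ($v\in V(G)$, $w\in V(\tilde G)$) consists of: $\sum_{v\in V(G)}x_{vw}-1$ for all $w$; $\sum_{w\in V(\tilde G)}x_{vw}-1$ for all $v$; and $x_{vw}x_{v'w'}$ whenever $\{(v,w),(v',w')\}$ is not a local isomorphism. A degree-$d$ Nullstellensatz refutation of a set $\mathsf P$ of polynomials over a field $\mathbb F$ consists of polynomials $f_p$ ($p\in\mathsf P$) and $g_x$ (for all variables $x$) with $\sum_{p\in\mathsf P}f_pp+\sum_x g_x(x^2-x)=1$, where the degree is the maximum degree of the polynomials $f_pp$. *)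

(* Defs.v *)
From HB Require Import structures.
From mathcomp Require Import all_boot all_order all_algebra finmap.
From mathcomp Require Import mpoly.

Set Implicit Arguments.
Unset Strict Implicit.
Unset Printing Implicit Defensive.

Import GRing.Theory.
Local Open Scope ring_scope.

Section NullstellensatzRefutation.
Variables (F : fieldType) (n : nat).
Implicit Types (P : {fset {mpoly F[n]}}) (f : {mpoly F[n]} -> {mpoly F[n]}).

Definition ns_refutation P f (g : 'I_n -> {mpoly F[n]}) : Prop :=
  \sum_(p <- P) f p * p + \sum_(i < n) g i * ('X_i ^+ 2 - 'X_i) = 1.

(* [msize p] is one more than the total degree of [p], and [msize 0 = 0]. *)
Definition ns_degree P f : nat := (\max_(p <- P) (msize (f p * p)).-1)%N.

Definition has_ns_refutation (d : nat) P : Prop :=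
  exists f g, ns_refutation P f g /\ (ns_degree P f <= d)%N.

End NullstellensatzRefutation.

(* [ecol x y] is meaningful only when [x] and [y] are adjacent. *)
Record cgraph (LV LE : eqType) := CGraph {
  cvert :> finType;
  vcol : cvert -> LV;
  adj : rel cvert;
  ecol : cvert -> cvert -> LE;
  adj_sym : ssrbool.symmetric adj;
  adj_irr : irreflexive adj;
  ecol_sym : forall x y, ecol x y = ecol y x
}.

Section GraphIsomorphism.
Variables (LV LE : eqType) (G G' : cgraph LV LE).

(* The first conjunct says that [pi] is (the graph of) an injective partial
   function. *)
Definition local_iso (pi : {set G * G'}) : bool :=
  [forall a in pi, forall b in pi,
    [&& (a.1 == b.1) == (a.2 == b.2),
        vcol a.1 == vcol a.2,
        adj a.1 b.1 == adj a.2 b.2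
      & adj a.1 b.1 ==> (ecol a.1 b.1 == ecol a.2 b.2)]].

Variable F : fieldType.

Definition niso_vars : nat := #|{: G * G'}|.

Definition iso_var (v : G) (w : G') : {mpoly F[niso_vars]} :=
  'X_(enum_rank (v, w)).

(* A pair [a.1 = a.2] is allowed: it contributes the square of a variable
   whose two vertices have different colours. *)
Definition Piso : {fset {mpoly F[niso_vars]}} :=
  ([fset (\sum_(v : G) iso_var v w - 1) | w in G']
   `|` [fset (\sum_(w : G') iso_var v w - 1) | v in G]
   `|` [fset (iso_var a.1.1 a.1.2 * iso_var a.2.1 a.2.2)
         | a in [pred a : (G * G') * (G * G')
                   | ~~ local_iso [set a.1; a.2]]])%fset.

End GraphIsomorphism.

Record sgraph := SGraph {
  svert :> finType;
  sadj : rel svert;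
  sadj_sym : ssrbool.symmetric sadj;
  sadj_irr : irreflexive sadj
}.

Section Tseitin.
Variable H : sgraph.

Definition edge_set : {set {set H}} :=
  [set e | [exists u, exists v, sadj u v && (e == [set u; v])]].

Definition edge : finType := {e : {set H} | e \in edge_set}.

(* [inc v] lists the edges incident to [v], in an arbitrary order. *)
Definition incidence_order (inc : H -> seq edge) : Prop :=
  forall v, perm_eq (inc v) (enum [pred e : edge | v \in val e]).

Variable inc : H -> seq edge.

Definition inc_edge v (i : 'I_(size (inc v))) : edge := tnth (in_tuple (inc v)) i.

Definition Delta k : {set 'rV['F_2]_k} :=
  [set b : 'rV['F_2]_k | \sum_(i < k) b ord0 i == 0].

(* The coset [Delta k + (1, 0, .., 0)]. For [k = 0] there is no first unit
   vector and the set is empty, in accordance with the unsatisfiable empty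
   equation [0 = 1]. *)
Definition Delta1 k : {set 'rV['F_2]_k} :=
  [set b + delta_mx ord0 i | b in Delta k, i in [pred i : 'I_k | i == 0 :> nat]].

Definition Tseitin_rel (T : {set H}) v : {set 'rV['F_2]_(size (inc v))} :=
  if v \in T then Delta1 _ else Delta _.

Section Graph.
Variable R : forall v : H, {set 'rV['F_2]_(size (inc v))}.

Definition constraint_vert (v : H) : finType :=
  {b : 'rV['F_2]_(size (inc v)) | b \in R v}.

(* [inl (e, a)] is a^(e) and [inr (Tagged _ b)], with [b : constraint_vert v],
   is b^(v); the colours L^(e), L^(v) are [inl e], [inr v], and the edge colour
   M^(i) is the 0-based position of the edge in [inc v]. *)
Definition csp_vert : finType := (edge * 'F_2 + {v : H & constraint_vert v})%type.

Definition csp_vcol (x : csp_vert) : (edge + H)%type :=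
  match x with inl ea => inl ea.1 | inr vb => inr (tag vb) end.

Definition csp_link (vb : {v : H & constraint_vert v}) (ea : edge * 'F_2) : bool :=
  [exists i : 'I_(size (inc (tag vb))),
    (inc_edge i == ea.1) && (val (tagged vb) ord0 i == ea.2)].

Definition csp_adj (x y : csp_vert) : bool :=
  match x, y with
  | inr vb, inl ea | inl ea, inr vb => csp_link vb ea
  | _, _ => false
  end.

Definition csp_ecol (x y : csp_vert) : nat :=
  match x, y with
  | inr vb, inl ea | inl ea, inr vb => index ea.1 (inc (tag vb))
  | _, _ => 0%N
  end.

Lemma csp_adj_sym : ssrbool.symmetric csp_adj.
Proof. by move=> [x|x] [y|y]. Qed.

Lemma csp_adj_irr : irreflexive csp_adj.
Proof. by case. Qed.

Lemma csp_ecol_sym x y : csp_ecol x y = csp_ecol y x.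
Proof. by case: x => x; case: y => y. Qed.

Definition csp_graph : cgraph (edge + H)%type nat :=
  CGraph csp_vcol csp_adj_sym csp_adj_irr csp_ecol_sym.

End Graph.

Definition Tseitin_graph (T : {set H}) := csp_graph (Tseitin_rel T).

Definition Tseitin_graph_tilde := csp_graph (fun v => Delta (size (inc v))).

End Tseitin.

(* Main.v *)
Require Import Defs.
From mathcomp Require Import all_boot all_order all_algebra finmap.
From mathcomp Require Import mpoly.

(** For an edge [e] of [H] let [z_e] be the variable sending 0^(e) to 1^(e), and
    fix a vertex b^(v) of [G]. If [e] is incident to [v], then modulo degree-2
    consequences of the axioms [z_e * x_{b,c} = (b_e + c_e) x_{b,c}] for all [c]
    in Delta, so multiplying the row axiom of b^(v) by [z_e] yields
    [z_e = \sum_c (b_e + c_e) x_{b,c}]. Summing over the edges at [v], and using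
    [\sum_e b_e = [v \in T]] and [\sum_e c_e = 0], one derives
    [\sum_(e at v) z_e = [v \in T]]. The sum of these equations over all [v] is
    [0 = |T| = 1], because every edge has two ends. If [R_v] is empty, the column
    axiom of 0^(v) already gives [0 = 1]. *)

Set Implicit Arguments.
Unset Strict Implicit.
Unset Printing Implicit Defensive.

Import GRing.Theory.

(** * Closure properties of bounded-degree Nullstellensatz derivations *)

Section Derivations.
Local Open Scope ring_scope.
Variables (F : fieldType) (n d : nat) (P : {fset {mpoly F[n]}}).
Implicit Types p q : {mpoly F[n]}.

(** For [q = 1] this unfolds to [has_ns_refutation d P]; a general [q] lets derivations be added
    up. *)
Definition ns_derivable q : Prop :=
  exists f g, \sum_(p <- P) f p * p + \sum_(i < n) g i * ('X_i ^+ 2 - 'X_i) = q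
              /\ (ns_degree P f <= d)%N.

Lemma ns_degreeP (f : {mpoly F[n]} -> {mpoly F[n]}) :
  reflect (forall p, p \in P -> (msize (f p * p) <= d.+1)%N)
          (ns_degree P f <= d)%N.
Proof.
apply: (iffP (bigmax_leqP_seq _ _ _ _)) => h p pP.
  by move: (h p pP isT); case: (msize _).
by move=> _; move: (h p pP); case: (msize _).
Qed.

Lemma ns_derivable0 : ns_derivable 0.
Proof.
exists (fun=> 0), (fun=> 0); split.
  by rewrite !big1 ?addr0 // => i _; rewrite mul0r.
by apply/ns_degreeP => p _; rewrite mul0r mmeasure0.
Qed.

Lemma ns_derivableD p q : ns_derivable p -> ns_derivable q -> ns_derivable (p + q).
Proof.
move=> [f [g [<- /ns_degreeP df]]] [f' [g' [<- /ns_degreeP df']]].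
exists (fun r => f r + f' r), (fun i => g i + g' i); split.
  rewrite addrACA -!big_split /=.
  by congr (_ + _); apply: eq_bigr => i _; rewrite mulrDl.
apply/ns_degreeP => r rP; rewrite mulrDl.
by apply: leq_trans (mmeasureD_le _ _ _) _; rewrite geq_max df ?df'.
Qed.

Lemma ns_derivableN p : ns_derivable p -> ns_derivable (- p).
Proof.
move=> [f [g [<- /ns_degreeP df]]].
exists (fun r => - f r), (fun i => - g i); split.
  by rewrite opprD -!sumrN; congr (_ + _); apply: eq_bigr => i _; rewrite mulNr.
by apply/ns_degreeP => r rP; rewrite mulNr mmeasureN df.
Qed.

Lemma ns_derivableB p q : ns_derivable p -> ns_derivable q -> ns_derivable (p - q).
Proof. by move=> dp dq; apply: ns_derivableD => //; apply: ns_derivableN. Qed.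

Lemma ns_derivable_sum (I : eqType) (r : seq I) (Q : pred I) (E : I -> {mpoly F[n]}) :
  (forall i, i \in r -> Q i -> ns_derivable (E i)) ->
  ns_derivable (\sum_(i <- r | Q i) E i).
Proof.
move=> dE; rewrite big_seq_cond; apply: big_ind => [||i /andP[]].
- exact: ns_derivable0.
- exact: ns_derivableD.
- exact: dE.
Qed.

Lemma ns_derivable_axiom p q :
  p \in P -> (msize (q * p) <= d.+1)%N -> ns_derivable (q * p).
Proof.
move=> pP dqp; exists (fun r => if r == p then q else 0), (fun=> 0); split.
  rewrite [X in _ + X]big1 ?addr0 => [|i _]; last by rewrite mul0r.
  rewrite (bigD1_seq p) ?fset_uniq //= eqxx big1 ?addr0 // => r /negPf->.
  by rewrite mul0r.
apply/ns_degreeP => r rP; case: eqP => [->//|_].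
by rewrite mul0r mmeasure0.
Qed.

(** Holds for every [d], because [ns_degree] does not measure the coefficients [g]. *)
Lemma ns_derivable_bool i : ns_derivable ('X_i ^+ 2 - 'X_i).
Proof.
exists (fun=> 0), (fun j => (j == i)%:R); split.
  rewrite big1 ?add0r => [|r _]; last by rewrite mul0r.
  rewrite (bigD1 i) //= eqxx mul1r big1 ?addr0 // => j /negPf->.
  by rewrite mul0r.
by apply/ns_degreeP => r rP; rewrite mul0r mmeasure0.
Qed.

Lemma msizeM_affine p q :
  (msize p <= 2)%N -> (msize q <= 2)%N -> (msize (p * q) <= 3)%N.
Proof.
have [->|p0] := eqVneq p 0; first by rewrite mul0r mmeasure0.
have [->|q0] := eqVneq q 0; first by rewrite mulr0 mmeasure0.
move=> dp dq; rewrite msizeM // -subn1 leq_subLR.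
exact: leq_add dp dq.
Qed.

End Derivations.

(** * Degree-2 consequences of the isomorphism axioms *)

Section IsoAxioms.
Local Open Scope ring_scope.
Variables (LV LE : eqType) (G G' : cgraph LV LE) (F : fieldType).
Local Notation x := (iso_var F).
Local Notation derivable := (ns_derivable 2 (Piso G G' F)).

Lemma msize_iso_var (v : G) (w : G') : msize (x v w) = 2%N.
Proof. by rewrite msizeX mdeg1. Qed.

Lemma msize_sum_iso_var (I : finType) (E : I -> G * G') :
  (msize (\sum_i x (E i).1 (E i).2 - 1) <= 2)%N.
Proof.
apply: leq_trans (mmeasureD_le _ _ _) _; rewrite mmeasureN msize1 geq_max andbT.
apply: leq_trans (mmeasure_sum _ _ _ _) _.
by apply/bigmax_leqP => i _; rewrite msize_iso_var.
Qed.

Lemma derivable_row (v : G) (l : {mpoly F[niso_vars G G']}) :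
  (msize l <= 2)%N -> derivable (l * (\sum_(w : G') x v w - 1)).
Proof.
move=> dl; apply: ns_derivable_axiom; last first.
  exact/msizeM_affine/(msize_sum_iso_var (fun w => (v, w))).
rewrite !in_fsetU; apply/orP; left; apply/orP; right.
by apply/imfsetP; exists v.
Qed.

Lemma derivable_col (w : G') (l : {mpoly F[niso_vars G G']}) :
  (msize l <= 2)%N -> derivable (l * (\sum_(v : G) x v w - 1)).
Proof.
move=> dl; apply: ns_derivable_axiom; last first.
  exact/msizeM_affine/(msize_sum_iso_var (fun v => (v, w))).
rewrite !in_fsetU; apply/orP; left; apply/orP; left.
by apply/imfsetP; exists w.
Qed.

Lemma derivable_nonlocal (v v' : G) (w w' : G') :
  ~~ local_iso [set (v, w); (v', w')] -> derivable (x v w * x v' w').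
Proof.
move=> nloc; rewrite -[_ * _]mul1r; apply: ns_derivable_axiom; last first.
  by rewrite mul1r msizeM_affine ?msize_iso_var.
rewrite !in_fsetU; apply/orP; right.
by apply/imfsetP; exists ((v, w), (v', w')).
Qed.

Lemma derivable_adj (v v' : G) (w w' : G') :
  adj v v' != adj w w' -> derivable (x v w * x v' w').
Proof.
move=> nadj; apply: derivable_nonlocal; apply: contra nadj.
by move=> /forall_inP/(_ _ (set21 _ _))/forall_inP/(_ _ (set22 _ _))/and4P[].
Qed.

Lemma derivable_vcolM (v v' : G) (w w' : G') :
  vcol v != vcol w -> derivable (x v w * x v' w').
Proof.
move=> ncol; apply: derivable_nonlocal; apply: contra ncol.
by move=> /forall_inP/(_ _ (set21 _ _))/forall_inP/(_ _ (set22 _ _))/and4P[].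
Qed.

(** The square of the variable is an axiom, and the Boolean axiom reduces the square to the
    variable. *)
Lemma derivable_vcol (v : G) (w : G') : vcol v != vcol w -> derivable (x v w).
Proof.
move=> ncol.
have -> : x v w = x v w * x v w - (x v w ^+ 2 - x v w).
  by rewrite expr2 opprB addrCA subrr addr0.
apply: ns_derivableB; [exact: derivable_vcolM | exact: ns_derivable_bool].
Qed.

(** Every term of the column sum of [w] is derivable, so the column axiom leaves the constant. *)
Lemma derivable1_of_missing_colour (w : G') :
  (forall v : G, vcol v != vcol w) -> derivable 1.
Proof.
move=> ncol.
have -> : 1 = \sum_(v : G) x v w - 1 * (\sum_(v : G) x v w - 1).
  by rewrite mul1r opprB addrCA subrr addr0.
apply: ns_derivableB; last by apply: derivable_col; rewrite msize1.
by apply: ns_derivable_sum => v _ _; apply: derivable_vcol.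
Qed.

End IsoAxioms.

(** * The parity argument for the Tseitin graphs *)

Section TseitinRefutation.
Local Open Scope ring_scope.
Variables (H : sgraph) (inc : H -> seq (edge H)).
Hypothesis inc_order : incidence_order inc.

Lemma inc_uniq v : uniq (inc v).
Proof. by rewrite (perm_uniq (inc_order v)) enum_uniq. Qed.

Lemma mem_inc v e : (e \in inc v) = (v \in val e).
Proof. by rewrite (perm_mem (inc_order v)) mem_enum. Qed.

Lemma inc_edge_inj v : injective (@inc_edge H inc v).
Proof.
move=> i j; rewrite /inc_edge !(tnth_nth (inc_edge i)) => /eqP /=.
by rewrite nth_uniq ?inc_uniq // => /eqP/val_inj.
Qed.

Lemma card_edge (e : edge H) : #|val e| = 2.
Proof.
case: e => e /=; rewrite inE => /existsP[u /existsP[v /andP[uv /eqP->]]].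
rewrite cards2; case: eqVneq uv => // ->.
by rewrite sadj_irr.
Qed.

Lemma F2_addrr (a : 'F_2) : a + a = 0.
Proof. by apply: addrr_pchar2; apply: pchar_Fp. Qed.

Lemma mpoly_F2_addrr n (p : {mpoly 'F_2[n]}) : p + p = 0.
Proof. by rewrite -[p]scale1r -scalerDl F2_addrr scale0r. Qed.

Lemma F2_neq_add (a b : 'F_2) : a != b -> a + b = 1.
Proof. by case: a b => [[|[|[]]] // ?] [[|[|[]]] // ?]; move=> h; apply/val_inj. Qed.

Section ConstraintValue.
Variable R : forall v : H, {set 'rV['F_2]_(size (inc v))}.
Implicit Type vb : {v : H & constraint_vert R v}.

(* The entry of the vector [vb] at the edge [e], and [0] if [e] is not incident
   to [tag vb]; indexing by edges makes vectors over different relations at the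
   same vertex comparable without casts. *)
Definition csp_val vb (e : edge H) : 'F_2 :=
  \sum_(i | inc_edge (v := tag vb) i == e) val (tagged vb) ord0 i.

Lemma csp_val_inc_edge vb i : csp_val vb (inc_edge i) = val (tagged vb) ord0 i.
Proof.
rewrite /csp_val (big_pred1 i) // => j.
by rewrite /= (inj_eq (@inc_edge_inj _)).
Qed.

(** Incidence is essential: at a non-incident edge [csp_val] takes the default value 0, but there is
    no link. *)
Lemma csp_linkE vb e a :
  e \in inc (tag vb) -> csp_link vb (e, a) = (csp_val vb e == a).
Proof.
case/(tnthP (in_tuple _)) => i ->; rewrite -/(inc_edge i) csp_val_inc_edge.
apply/existsP/eqP => [[j /andP[/eqP/inc_edge_inj-> /eqP]]//|<-].
by exists i; rewrite !eqxx.
Qed.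

Lemma sum_csp_val vb :
  \sum_(e <- inc (tag vb)) csp_val vb e = \sum_i val (tagged vb) ord0 i.
Proof.
rewrite big_tnth; apply: eq_bigr => i _.
exact: csp_val_inc_edge.
Qed.

End ConstraintValue.

Lemma sum_Tseitin_rel (T : {set H}) v b :
  b \in Tseitin_rel inc T v -> \sum_i b ord0 i = (v \in T)%:R.
Proof.
rewrite /Tseitin_rel; case: ifP => _; last by rewrite inE => /eqP.
case/imset2P => c i; rewrite inE => /eqP c0 _ ->.
under eq_bigr do rewrite mxE; rewrite big_split /= c0 add0r.
rewrite (bigD1 i) //= mxE !eqxx big1 ?addr0 // => j /negPf nij.
by rewrite mxE nij andbF.
Qed.

Variable T : {set H}.
Local Notation G := (Tseitin_graph inc T).
Local Notation G' := (Tseitin_graph_tilde inc).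
Local Notation x := (@iso_var _ _ G G' 'F_2).
Local Notation derivable := (ns_derivable 2 (Piso G G' 'F_2)).

Definition flip_var (e : edge H) := x (inl (e, 0)) (inl (e, 1)).

(** If the entries at [e] agree, sending 0^(e) to 1^(e) breaks adjacency with b^(v); if they differ,
    fixing 0^(e) does, so the row axiom of 0^(e) forces the flip. *)
Lemma derivable_flip_mul (b : {v : H & constraint_vert (Tseitin_rel inc T) v})
    (c : {v : H & constraint_vert (fun v => Delta (size (inc v))) v}) e :
    tag b = tag c -> e \in inc (tag b) ->
  derivable (flip_var e * x (inr b) (inr c)
             - (csp_val b e + csp_val c e) *: x (inr b) (inr c)).
Proof.
move=> bc eb; have ec : e \in inc (tag c) by rewrite -bc.
have [eq_bc|neq_bc] := eqVneq (csp_val b e) (csp_val c e).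
  rewrite eq_bc F2_addrr scale0r subr0; apply: derivable_adj.
  rewrite /= !csp_linkE // eq_bc.
  by move: (csp_val c e); case=> [[|[|[]]]].
rewrite F2_neq_add // scale1r.
set y := x _ _.
(* The row axiom of 0^(e), multiplied by [y], with the target 1^(e) split off. *)
have -> : flip_var e * y - y = y * (\sum_(w : G') x (inl (e, 0)) w - 1)
    - \sum_(w : G' | w != inl (e, 1)) x (inl (e, 0)) w * y.
  rewrite (bigD1 (inl (e, 1) : G')) //= -mulr_suml mulrBr mulr1 mulrDr.
  rewrite [y * _]mulrC [y * \sum_(i | _) _]mulrC.
  by rewrite [RHS]addrAC addrK.
apply: ns_derivableB; first by apply: derivable_row; rewrite msize_iso_var.
apply: ns_derivable_sum => -[[e' a]|c'] _ w1; last exact: derivable_vcolM.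
have [ee'|ne] := eqVneq e e'; last by apply: derivable_vcolM.
rewrite -ee' in w1 *.
(* The only remaining target of colour L^(e) is 0^(e). *)
have -> : a = 0.
  move: w1; case: a => [[|[|[]]] // ?]; first by move=> _; apply/val_inj.
  by move/eqP; case; congr (inl (_, _)); apply/val_inj.
apply: derivable_adj; rewrite /= !csp_linkE //; apply: contra neq_bc.
by move: (csp_val b e) (csp_val c e) => [[|[|[]]] // ?] [[|[|[]]] // ?].
Qed.

Lemma derivable_vertex (b : {v : H & constraint_vert (Tseitin_rel inc T) v}) :
  derivable (\sum_(e <- inc (tag b)) flip_var e - (tag b \in T)%:R).
Proof.
(* Targets of the wrong colour get coefficient 0: their products with [flip_var e] are axioms. *)
pose cf (w : G') e : 'F_2 :=
  if w is inr c then if tag b == tag c then csp_val b e + csp_val c e else 0 else 0.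
have flipE e : e \in inc (tag b) ->
    derivable (flip_var e - \sum_(w : G') cf w e *: x (inr b) w).
  move=> eb.
  have -> : flip_var e - \sum_(w : G') cf w e *: x (inr b) w =
      \sum_(w : G') (flip_var e * x (inr b) w - cf w e *: x (inr b) w)
      - flip_var e * (\sum_(w : G') x (inr b) w - 1).
    by rewrite sumrB -mulr_sumr mulrBr mulr1 opprB [RHS]addrC addrA subrK.
  apply: ns_derivableB; last by apply: derivable_row; rewrite msize_iso_var.
  apply: ns_derivable_sum => -[[e' a]|c] _ _ /=.
    by rewrite scale0r subr0 mulrC; apply: derivable_vcolM.
  have [bc|nbc] := eqVneq; first exact: derivable_flip_mul.
  by rewrite scale0r subr0 mulrC; apply: derivable_vcolM.
have sum_cf (w : G') : vcol (inr b : G) = vcol w ->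
    \sum_(e <- inc (tag b)) cf w e = (tag b \in T)%:R.
  case: w => [//|c] /= [bc]; rewrite -bc eqxx big_split /= sum_csp_val.
  rewrite (sum_Tseitin_rel (valP (tagged b))) [X in _ + X = _](_ : _ = 0) ?addr0 //.
  rewrite bc sum_csp_val; apply/eqP.
  by have := valP (tagged c); rewrite /= inE.
set t := (tag b \in T)%:R.
(* Exchanging the sums and expanding [t] by the row axiom of [b] allows a comparison of coefficients
   target by target. *)
have -> : \sum_(e <- inc (tag b)) flip_var e - t =
    \sum_(e <- inc (tag b)) (flip_var e - \sum_(w : G') cf w e *: x (inr b) w)
    + (\sum_(w : G') (\sum_(e <- inc (tag b)) cf w e *: x (inr b) w - t * x (inr b) w)
    + t * (\sum_(w : G') x (inr b) w - 1)).
  rewrite !sumrB -mulr_sumr exchange_big /= mulrBr mulr1.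
  by rewrite !addrA subrK subrK.
apply: ns_derivableD; first by apply: ns_derivable_sum => e eb _; apply: flipE.
apply: ns_derivableD; last first.
  by apply: derivable_row; rewrite /t; case: (_ \in T); rewrite ?msize1 ?mmeasure0.
apply: ns_derivable_sum => w _ _; rewrite -scaler_suml.
have [bw|nbw] := eqVneq (vcol (inr b : G)) (vcol w).
  rewrite sum_cf // /t; case: (_ \in T); rewrite ?scale1r ?mul1r ?scale0r ?mul0r subrr;
  exact: ns_derivable0.
have dx := derivable_vcol 'F_2 nbw.
apply: ns_derivableB; last first.
  by rewrite /t; case: (_ \in T); rewrite ?mul1r ?mul0r //; apply: ns_derivable0.
(* A scalar of F_2 is 0 or 1, so the scaled variable is 0 or the derivable variable itself. *)
have [->|/F2_neq_add] := eqVneq (\sum_(e <- inc (tag b)) cf w e) 0.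
  by rewrite scale0r; apply: ns_derivable0.
by rewrite addr0 => ->; rewrite scale1r.
Qed.

(** Each edge is counted once at each of its two ends, and the characteristic is 2. *)
Lemma sum_flip_var : \sum_v \sum_(e <- inc v) flip_var e = 0.
Proof.
have e1 v : \sum_(e <- inc v) flip_var e = \sum_(e : edge H | v \in val e) flip_var e.
  by rewrite (perm_big _ (inc_order v)) big_enum.
under eq_bigr do rewrite e1.
rewrite (exchange_big_dep predT) //= big1 // => e _.
by rewrite sumr_const card_edge mulr2n mpoly_F2_addrr.
Qed.

Lemma derivable1 : odd #|T| -> derivable 1.
Proof.
move=> oddT.
(* Either some colour L^(v) is missing from [G], that is, R_v is empty, or every [v] supplies a
   vertex b^(v). In the first case the zero vector, always in [Delta], gives the column to use. *)
have [/existsP[v /forallP nv]|/existsPn allv] :=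
    boolP [exists v, forall u : G, vcol u != inr v].
  have z0 : 0 \in Delta (size (inc v)).
    by rewrite inE big1 // => i _; rewrite mxE.
  pose R0 u := constraint_vert (fun u' => Delta (size (inc u'))) u.
  pose w : G' := inr (Tagged R0 (exist _ 0 z0 : R0 v)).
  exact: (@derivable1_of_missing_colour _ _ G G' _ w).
have -> : 1 = - \sum_v (\sum_(e <- inc v) flip_var e - (v \in T)%:R).
  have -> : \sum_v (\sum_(e <- inc v) flip_var e - (v \in T)%:R) = - \sum_(v in T) 1.
    rewrite sumrB sum_flip_var sub0r [in RHS]big_mkcond; congr (- _).
    by apply: eq_bigr => v _; case: (v \in T).
  (* Write the odd number |T| as 1 plus a double; the double vanishes in characteristic 2. *)
  rewrite opprK sumr_const -(odd_double_half #|T|) oddT -addnn !mulrnDr mpoly_F2_addrr.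
  by rewrite addr0.
apply: ns_derivableN; apply: ns_derivable_sum => v _ _.
have /forallPn[[?|b]] := allv v; rewrite negbK // => /eqP[<-].
exact: derivable_vertex.
Qed.

End TseitinRefutation.

Theorem theorem4 (H : sgraph) (T : {set H}) (inc : H -> seq (edge H)) :
  incidence_order inc -> odd #|T| ->
  has_ns_refutation 2 (Piso (Tseitin_graph inc T) (Tseitin_graph_tilde inc) 'F_2).
Proof. by move=> inc_order oddT; apply: (derivable1 inc_order oddT). Qed.
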